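(* For every integer $k\ge 1$, $$a_k=k+2\sum_{i\ge 1}\left\lfloor\frac{k}{3^i}\right\rfloor 5^{i-1}.$$
   Context: $\{a_k\}_{k\ge 1}$ denotes the set of all positive integers $n$, listed in increasing order $a_1<a_2<\cdots$, for which $\binom{2n}{n}$ is not divisible by 5. The sum has only finitely many nonzero terms. *)

(* Defs.v *)
From mathcomp Require Import all_boot zify.

Set Implicit Arguments.
Unset Strict Implicit.
Unset Printing Implicit Defensive.

Definition good5 (n : nat) : bool := ~~ (5 %| 'C(2 * n, n)).

Lemma good5_exp j : good5 (5 ^ j).
Proof.
rewrite /good5; set n := 5 ^ j.
have n_gt0 : 0 < n by rewrite expn_gt0.
have C_gt0 : 0 < 'C(2 * n, n) by rewrite bin_gt0 leq_pmull.
have le_n : n <= 2 * n by rewrite leq_pmull.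
have fact_n : logn 5 n`! = \sum_(1 <= k < (2 * n).+1) n %/ 5 ^ k.
  rewrite logn_fact // (@big_cat_nat _ _ _ n.+1 1 (2 * n).+1) //=.
  rewrite [X in _ = _ + X](_ : _ = 0) ?addn0 // big_nat_cond big1 // => k.
  rewrite andbT => /andP[ltnk _].
  by rewrite divn_small // (ltn_trans ltnk) // ltn_expl.
have fact_2n : logn 5 (2 * n)`! = 2 * logn 5 n`!.
  rewrite fact_n logn_fact // big_distrr /=; apply: eq_bigr => k _.
  case: (leqP k j) => [lekj | ltjk].
    by rewrite muln_divA // dvdn_exp2l.
  have lt_2n : 2 * n < 5 ^ k.
    apply: (@leq_trans (5 ^ j.+1)); last by rewrite leq_exp2l.
    by rewrite expnS ltn_pmul2r.
  by rewrite !divn_small // (leq_ltn_trans le_n).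
have := congr1 (logn 5) (bin_fact le_n).
have -> : 2 * n - n = n by rewrite mul2n -addnn addnK.
rewrite !lognM ?muln_gt0 ?fact_gt0 // fact_2n => logC.
have {logC} : logn 5 'C(2 * n, n) = 0 by lia.
by move/eqP; apply: contraL => d5; rewrite -lt0n logn_gt0 mem_primes C_gt0 d5.
Qed.

Lemma good5_unbounded m : exists n, (m < n) && good5 n.
Proof. by exists (5 ^ m); rewrite good5_exp ltn_expl. Qed.

(* Least n > m such that 5 does not divide 'C(2n, n). *)
Definition next_good5 (m : nat) : nat := ex_minn (good5_unbounded m).

(* The junk value a_ 0 = 0 only starts the recursion: 0 is not in the list,
   and a_ 1 is the least positive integer satisfying good5. *)
Definition a_ (k : nat) : nat := iter k next_good5 0.

Lemma aseq_ltS k : a_ k < a_ k.+1.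
Proof. by rewrite /a_ iterS /next_good5; case: ex_minnP => n /andP[]. Qed.

Lemma aseq_rangeP n :
  reflect (exists2 k, 1 <= k & a_ k = n) ((0 < n) && good5 n).
Proof.
have Pa k : good5 (a_ k.+1).
  by rewrite /a_ iterS /next_good5; case: ex_minnP => m /andP[].
apply: (iffP andP) => [[n_gt0 Pn] | [[//|k] _ <-]]; last first.
  by split; [exact: leq_ltn_trans (leq0n _) (aseq_ltS k) | exact: Pa].
have le_a k : k <= a_ k by elim: k => // k /leq_ltn_trans; apply; exact: aseq_ltS.
have ex_k : exists k, n <= a_ k by exists n.
case: (ex_minnP ex_k) => -[|k]; first by rewrite leqNgt n_gt0.
move=> le_n min_k; exists k.+1 => //; apply/eqP; rewrite eqn_leq le_n andbT.
have lt_n : a_ k < n by rewrite ltnNge; apply/negP => /min_k; rewrite ltnn.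
rewrite {1}/a_ iterS /next_good5; case: ex_minnP => m _; apply.
by rewrite -/(a_ k) lt_n.
Qed.

(* Main.v *)
Require Import Defs.
From mathcomp Require Import all_boot zify.
From mathcomp Require Import boolp classical_sets fsbigop.

(** By Legendre's formula the exponent of 5 in the central binomial coefficient
    of n counts the carries in the base-5 addition n + n.  Hence 5 does not
    divide it exactly when every base-5 digit of n is 0, 1 or 2.  These n are
    the numbers obtained by writing some k in base 3 and reading the digits in
    base 5, and this reading is increasing in k, so a_k is the reading of k.

    Counting in base 3 from 0 to k produces floor(k / 3^i) carries into position
    i.  In the base-5 reading, each of them trades three units of weight 5^(i-1)
    for one of weight 5^i, a gain of 2 * 5^(i-1), while each of the k counting
    steps adds 1.  This is the formula of the theorem.

    Formally, both the set and the formula are governed by a recursion on the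
    last digit: [good5_rec] strips a base-5 digit, [ternary_in_base5_rec] a
    base-3 digit.  Comparing them gives [good5P], which says that the values of
    the formula are the good numbers; monotonicity then gives [aE]. *)

(** The sums over all powers of a base have finite support, so any bound beyond
    n may be used; this lets sums for different arguments share a range. *)
Lemma sum_floor_trunc b (w : nat -> nat) n m : 1 < b -> n <= m ->
  \sum_(i < m) n %/ b ^ i.+1 * w i = \sum_(i < n) n %/ b ^ i.+1 * w i.
Proof.
move=> b_gt1; elim: m => [|m IHm]; first by rewrite leqn0 => /eqP->.
rewrite leq_eqVlt => /predU1P[-> //|lenm].
rewrite big_ord_recr /= IHm // divn_small ?addn0 //.
exact: ltn_trans lenm (ltn_expl _ b_gt1).
Qed.

(** Iterated floors compose, so dividing n by b shifts the sum by one index.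
    The arbitrary weights w cover both Legendre's formula (w = 1) and the
    formula for the sequence (w i = 5 ^ i). *)
Lemma sum_floor_rec b (w : nat -> nat) n : 1 < b ->
  \sum_(i < n) n %/ b ^ i.+1 * w i =
  n %/ b * w 0 + \sum_(i < n %/ b) n %/ b %/ b ^ i.+1 * w i.+1.
Proof.
move=> b_gt1; case: n => [|n]; first by rewrite div0n !big_ord0.
rewrite big_ord_recl expn1; congr (_ + _).
rewrite -(sum_floor_trunc b (fun i => w i.+1) _ n b_gt1).
  by apply: eq_bigr => i _; rewrite -divnMA -expnS.
by rewrite -ltnS ltn_Pdiv.
Qed.

Lemma logn_fact_rec p n : prime p ->
  logn p n`! = n %/ p + logn p (n %/ p)`!.
Proof.
move=> p_pr; have b_gt1 := prime_gt1 p_pr.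
have legendre m : logn p m`! = \sum_(i < m) m %/ p ^ i.+1 * 1.
  rewrite logn_fact // big_add1 big_mkord.
  by apply: eq_bigr => i _; rewrite muln1.
by rewrite !legendre (sum_floor_rec p (fun=> 1)) ?muln1.
Qed.

(** The form of the condition to which [logn_fact_rec] applies on both sides. *)
Lemma good5E n : good5 n = (logn 5 (2 * n)`! == 2 * logn 5 n`!).
Proof.
have C_gt0 : 0 < 'C(2 * n, n) by rewrite bin_gt0 leq_pmull.
have -> : good5 n = (logn 5 'C(2 * n, n) == 0).
  by rewrite /good5 -leqn0 leqNgt logn_gt0 mem_primes C_gt0.
have le_n : n <= 2 * n by rewrite leq_pmull.
have := congr1 (logn 5) (bin_fact le_n).
have -> : 2 * n - n = n by lia.
rewrite !lognM ?muln_gt0 ?fact_gt0 //; lia.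
Qed.

(** Write n = 5 m + d.  If d <= 2 then doubling n carries nothing out of the last
    digit, and the comparison of exponents for n reduces to the one for m.  If
    d >= 3 there is a carry, which forces a factor 5. *)
Lemma good5_rec n : good5 n = (n %% 5 <= 2) && good5 (n %/ 5).
Proof.
rewrite !good5E (logn_fact_rec 5 (2 * n)) // (logn_fact_rec 5 n) //.
set m := n %/ 5; case: leqP => digit.
  have -> : 2 * n %/ 5 = 2 * m by lia.
  lia.
have -> : 2 * n %/ 5 = (2 * m).+1 by lia.
(* Since m! ^ 2 divides (2m)!, the carry makes the exponent of (2n)! exceed
   that of n! ^ 2 strictly, whatever the higher digits are. *)
have le_m : m <= 2 * m by lia.
have := congr1 (logn 5) (bin_fact le_m).
have -> : 2 * m - m = m by lia.
rewrite factS !lognM ?muln_gt0 ?fact_gt0 ?bin_gt0 //; lia.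
Qed.

(** The formula of the theorem as a finite sum; by [ternary_in_base5_rec] it is
    the base-5 reading of the base-3 digits of k. *)
Definition ternary_in_base5 k := k + 2 * \sum_(i < k) k %/ 3 ^ i.+1 * 5 ^ i.

Lemma ternary_in_base5_rec k :
  ternary_in_base5 k = 5 * ternary_in_base5 (k %/ 3) + k %% 3.
Proof.
rewrite /ternary_in_base5 (sum_floor_rec 3 (expn 5)) // muln1.
set q := k %/ 3.
have -> : \sum_(i < q) q %/ 3 ^ i.+1 * 5 ^ i.+1 =
    5 * \sum_(i < q) q %/ 3 ^ i.+1 * 5 ^ i.
  by rewrite big_distrr; apply: eq_bigr => i _; rewrite (expnS 5) mulnCA.
lia.
Qed.

(** On a common range of summation each floor is nondecreasing in k, while the
    leading term k is increasing. *)
Lemma ternary_in_base5_ltS k : ternary_in_base5 k < ternary_in_base5 k.+1.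
Proof.
rewrite /ternary_in_base5 -(sum_floor_trunc 3 (expn 5) k k.+1) // addSn ltnS.
rewrite leq_add2l leq_mul2l /=.
by apply: leq_sum => i _; rewrite leq_mul2r leq_div2r ?orbT.
Qed.

(** Both directions go digit by digit: a last base-5 digit at most 2 is the same
    thing as a last base-3 digit. *)
Lemma good5P n : reflect (exists k, ternary_in_base5 k = n) (good5 n).
Proof.
have good0 : good5 0 by rewrite good5E.
have val0 : ternary_in_base5 0 = 0 by rewrite /ternary_in_base5 big_ord0.
apply: (iffP idP) => [|[k <-{n}]].
  elim/ltn_ind: n => -[|n] IHn; first by exists 0.
  rewrite good5_rec => /andP[digit]; case/IHn=> [|q def_q]; first by lia.
  exists (3 * q + n.+1 %% 5); rewrite ternary_in_base5_rec.
  have -> : (3 * q + n.+1 %% 5) %/ 3 = q by lia.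
  lia.
elim/ltn_ind: k => -[|k] IHk; first by rewrite val0.
rewrite good5_rec ternary_in_base5_rec.
set v := ternary_in_base5 _.
have -> : (5 * v + k.+1 %% 3) %/ 5 = v by lia.
by rewrite IHk; lia.
Qed.

(** An increasing map whose values are exactly the good numbers must send k.+1 to
    the least good number above its value at k. *)
Lemma aE k : a_ k = ternary_in_base5 k.
Proof.
have lt_val : {homo ternary_in_base5 : i j / i < j}.
  by apply: homo_ltn; [exact: ltn_trans | exact: ternary_in_base5_ltS].
have le_val : {homo ternary_in_base5 : i j / i <= j}.
  exact: ltnW_homo.
elim: k => [|k IHk]; first by rewrite /ternary_in_base5 big_ord0.
rewrite /a_ iterS -/(a_ k) IHk /next_good5.
case: ex_minnP => n /andP[gt_n /good5P[j def_n]] min_n.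
apply/eqP; rewrite eqn_leq min_n /=; last first.
  by rewrite ternary_in_base5_ltS; apply/good5P; exists k.+1.
rewrite -def_n le_val // ltnNge; apply/negP => /le_val.
by rewrite def_n leqNgt gt_n.
Qed.

Local Open Scope classical_set_scope.

Theorem corollary1p1 (k : nat) (hk : 1 <= k) :
  a_ k = k + 2 * \big[addn/0]_(i \in [set i : nat | 1 <= i]) (k %/ 3 ^ i * 5 ^ (i - 1)).
Proof.
rewrite aE /ternary_in_base5; congr (_ + 2 * _).
rewrite (fsbigE (index_iota 1 k.+1)) ?iota_uniq //=; last 2 first.
- by move=> i /=; rewrite mem_index_iota => /andP[].
- move=> i /= i_gt0; rewrite mem_index_iota i_gt0 /= ltnS -ltnNge => lt_ki.
  by rewrite divn_small // (ltn_trans lt_ki) // ltn_expl.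
rewrite [RHS]big_rmcond_in; last first.
  by move=> i; rewrite mem_index_iota => /andP[i_gt0 _] /negP[]; apply/mem_set.
rewrite big_add1 big_mkord; apply: eq_bigr => i _.
by rewrite subn1.
Qed.
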